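(* Let $\widetilde{b}_n$ be the number of unlabeled bicolored graphs on $n$ vertices. Then, as $n\to\infty$, $$\widetilde{b}_n\sim\frac{c(n)}{\lfloor n/2\rfloor!\,\lceil n/2\rceil!}\,2^{n^2/4},$$ where $c(n)=\sum_{k\in\mathbb{Z}}2^{-k^2}$ if $n$ is even and $c(n)=\sum_{k\in\mathbb{Z}}2^{-(k+\frac12)^2}$ if $n$ is odd.
   Context: Graphs are finite and simple. A bicolored graph is a graph in which each vertex is colored green or red such that no two adjacent vertices have the same color; the colors are not interchangeable, and isomorphisms of bicolored graphs are the graph isomorphisms that preserve color. Unlabeled bicolored graphs are isomorphism classes of bicolored graphs under color-preserving isomorphism. The notation $x_n\sim y_n$ means $\lim_{n\to\infty}x_n/y_n=1$. *)

(* Defs.v *)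
From HB Require Import structures.
From mathcomp Require Import all_boot all_order all_algebra all_fingroup.
From mathcomp Require Import all_classical all_reals all_analysis.
Set Implicit Arguments.
Unset Strict Implicit.
Unset Printing Implicit Defensive.
Import Order.TTheory GRing.Theory Num.Theory.
Import numFieldNormedType.Exports.

(* Colors are booleans: [true] is green and [false] is red. *)
Definition bicolored_axiom (V : finType)
    (g : {ffun V -> bool} * {ffun V * V -> bool}) : bool :=
  [&& [forall x, ~~ g.2 (x, x)],
      [forall x, forall y, g.2 (x, y) == g.2 (y, x)] &
      [forall x, forall y, g.2 (x, y) ==> (g.1 x != g.1 y)]].

Record bicolored_graph (V : finType) := BicoloredGraph {
  bicolored_data : {ffun V -> bool} * {ffun V * V -> bool};
  _ : bicolored_axiom bicolored_data }.

HB.instance Definition _ (V : finType) :=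
  [isSub for @bicolored_data V].
HB.instance Definition _ (V : finType) :=
  [Finite of bicolored_graph V by <:].

Definition color (V : finType) (g : bicolored_graph V) (x : V) : bool :=
  (bicolored_data g).1 x.

Definition adj (V : finType) (g : bicolored_graph V) (x y : V) : bool :=
  (bicolored_data g).2 (x, y).

Definition bicolored_iso (V : finType) (g h : bicolored_graph V) : bool :=
  [exists s : {perm V},
    [forall x, color h (s x) == color g x] &&
    [forall x, forall y, adj h (s x) (s y) == adj g x y]].

Lemma bicolored_isoP (V : finType) (g h : bicolored_graph V) :
  reflect (exists s : {perm V},
      (forall x, color h (s x) = color g x) /\
      (forall x y, adj h (s x) (s y) = adj g x y))
    (bicolored_iso g h).
Proof.
apply: (iffP existsP) => -[s].
  case/andP=> /forallP Hc /forallP He; exists s; split=> [x|x y].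
    exact/eqP.
  by move/forallP: (He x) => /(_ y)/eqP.
case=> Hc He; exists s; apply/andP; split; first by apply/forallP=> x; apply/eqP.
by apply/forallP=> x; apply/forallP=> y; apply/eqP.
Qed.

Lemma bicolored_iso_equiv (V : finType) :
  equivalence_rel (@bicolored_iso V).
Proof.
have refl (g : bicolored_graph V) : bicolored_iso g g.
  by apply/bicolored_isoP; exists 1%g; split=> *; rewrite !perm1.
have sym (g h : bicolored_graph V) : bicolored_iso g h -> bicolored_iso h g.
  case/bicolored_isoP=> s [Hc He]; apply/bicolored_isoP; exists s^-1%g.
  by split=> [x|x y]; rewrite -?Hc -?He !permKV.
have trans (g h k : bicolored_graph V) :
    bicolored_iso g h -> bicolored_iso h k -> bicolored_iso g k.
  case/bicolored_isoP=> s [Hc He] /bicolored_isoP[t [Hc' He']].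
  apply/bicolored_isoP; exists (s * t)%g.
  by split=> [x|x y]; rewrite !permM ?Hc' ?He'.
move=> g h k; split; first exact: refl.
move=> gh; apply/idP/idP; last exact: trans.
by apply: trans; apply: sym.
Qed.

Definition num_unlabeled_bicolored (n : nat) : nat :=
  #|equivalence_partition (@bicolored_iso 'I_n)
      [set: bicolored_graph 'I_n]|.

Local Open Scope ring_scope.

(* The series have nonnegative terms and converge, so [fine] only moves the
   extended-real sum back to [R]. *)
Definition theta_const (R : realType) (n : nat) : R :=
  if odd n then
    fine (\esum_(k in [set: int]%classic)
      (2 `^ (- ((k%:~R + 2^-1) ^+ 2)))%:E)
  else
    fine (\esum_(k in [set: int]%classic) (2 `^ (- (k%:~R ^+ 2)))%:E).

(* Main.v *)
(* By Burnside's lemma, [n! * b_n] is the number of pairs of a permutation of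
   the vertices and a bicolored graph that it fixes.  The identity contributes
   [\sum_k 'C(n, k) 2^(k(n-k))].  A permutation moving [r] points and preserving
   the coloring has at most half as many orbits on the moved green-red pairs as
   there are such pairs, so it fixes at most [2^n * 2^((n^2 + (n-r)^2) / 8)]
   graphs; there are at most [n^r] such permutations, and the total over [r > 0]
   is exponentially smaller than the identity term.  Writing [k = uphalf n + j],
   the identity term divided by ['C(n, uphalf n) 2^(n^2/4)] is the sum over [j]
   of ['C(n, k) / 'C(n, uphalf n) * 2^(-(j + odd n / 2)^2)], whose weights are at
   most [1] and at least [1 - N(N+1) / (uphalf n + 1)] when [|j| <= N]. *)
Require Import Defs.
From mathcomp Require Import all_boot all_order all_algebra all_fingroup.
From mathcomp Require Import zify.
Set Implicit Arguments.
Unset Strict Implicit.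
Unset Printing Implicit Defensive.
Import Order.TTheory GRing.Theory Num.Theory.

Section PermutationOrbits.
Variables (T : finType) (t : {perm T}).

Lemma card_porbit_imset (P : {set T}) : {in P, forall x, t x \in P} ->
  2 * #|porbit t @: P| <= #|P| + #|[set x in P | t x == x]|.
Proof.
move=> tP.
have -> : #|P| + #|[set x in P | t x == x]| = \sum_(x in P) (1 + (t x == x)).
  rewrite big_split /= sum1_card; congr (_ + _).
  by rewrite -big_mkcondr /= sum1dep_card.
(* Each orbit weighs at least 2: it is a fixed point or has two elements. *)
rewrite (partition_big_imset (porbit t)) /= mulnC -sum_nat_const.
apply: leq_sum => B /imsetP[x Px ->].
rewrite (bigD1 x) ?Px ?eqxx //=; case: eqVneq => [//|tx_neq].
have := porbit_perm t 1 x; rewrite expg1 => tx_orbit.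
by rewrite (bigD1 (t x)) //= tP // tx_neq tx_orbit eqxx.
Qed.

Lemma card_invariant_sets (P : {set T}) :
  #|[set S : {set T} | (S \subset P) && [forall x, (t x \in S) == (x \in S)]]|
    <= 2 ^ #|porbit t @: P|.
Proof.
rewrite -card_powerset -(card_in_imset (f := fun S : {set T} => porbit t @: S)).
  apply/subset_leq_card/subsetP => _ /imsetP[S + ->].
  by rewrite !inE => /andP[SP _]; exact: imsetS.
have mem_orbit (S : {set T}) x : [forall x, (t x \in S) == (x \in S)] ->
    (porbit t x \in porbit t @: S) = (x \in S).
  move=> /forallP tS; apply/imsetP/idP => [[y Sy /eqP]|Sx]; last by exists x.
  rewrite eq_porbit_mem => /porbitP[i ->]; elim: i => [|i IH].
    by rewrite expg0 perm1.
  by rewrite expgSr permM (eqP (tS _)).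
move=> S1 S2; rewrite !inE => /andP[_ inv1] /andP[_ inv2] eqS.
by apply/setP => x; rewrite -(mem_orbit S1) // eqS mem_orbit.
Qed.

End PermutationOrbits.

Lemma card_perm_moving (T : finType) (r : nat) :
  #|[set s : {perm T} | #|[set x | s x != x]| == r]| <= #|T| ^ r.
Proof.
apply: (@leq_trans (\sum_(A : {set T} | #|A| == r) #|perm_on A|)).
  rewrite -sum1_card (partition_big (fun s : {perm T} => [set x | s x != x])
    (fun A => #|A| == r)) => [|s]; last by rewrite inE.
  apply: leq_sum => A _; rewrite sum1dep_card; apply/subset_leq_card/subsetP => s.
  by rewrite !inE => /andP[_ /eqP <-]; apply/subsetP => x; rewrite !inE.
under eq_bigr => A /eqP Ar do rewrite card_perm Ar.
rewrite sum_nat_const.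
have -> : #|[pred A : {set T} | #|A| == r]| = 'C(#|T|, r).
  by rewrite -card_draws cardsE.
rewrite bin_ffact; elim: r => [|r IH]; first by rewrite ffactn0.
by rewrite ffactnSr expnSr leq_mul // leq_subr.
Qed.

Section BicoloredGraphs.
Variable V : finType.
Implicit Types (g h : bicolored_graph V) (s t : {perm V}) (A : {set V}).

Lemma adj_irrefl g x : adj g x x = false.
Proof. by have /and3P[/forallP /(_ x)/negbTE] := valP g. Qed.

Lemma adj_sym g x y : adj g x y = adj g y x.
Proof.
by have /and3P[_ /forallP /(_ x)/forallP/(_ y)/eqP] := valP g.
Qed.

Lemma adj_color g x y : adj g x y -> color g x != color g y.
Proof.
by have /and3P[_ _ /forallP /(_ x)/forallP/(_ y)/implyP] := valP g.
Qed.

Lemma bicolored_ext g h :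
  color g =1 color h -> (forall x y, adj g x y = adj h x y) -> g = h.
Proof.
move=> eqc eqe; apply: val_inj.
rewrite [LHS]surjective_pairing [RHS]surjective_pairing.
by congr pair; apply/ffunP; [exact: eqc | case; exact: eqe].
Qed.

Lemma bicolored_act_subproof g s : bicolored_axiom
  ([ffun x => color g (s^-1 x)%g],
   [ffun p => adj g (s^-1 p.1)%g (s^-1 p.2)%g]).
Proof.
apply/and3P; split; apply/forallP => x; rewrite /= ?ffunE ?adj_irrefl //.
  by apply/forallP => y; rewrite !ffunE /= adj_sym.
by apply/forallP => y; rewrite !ffunE; apply/implyP => /adj_color.
Qed.

Definition bicolored_act g s := BicoloredGraph (bicolored_act_subproof g s).

Lemma color_act g s x : color (bicolored_act g s) x = color g (s^-1 x)%g.
Proof. by rewrite /color ffunE. Qed.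

Lemma adj_act g s x y :
  adj (bicolored_act g s) x y = adj g (s^-1 x)%g (s^-1 y)%g.
Proof. by rewrite /adj ffunE. Qed.

Lemma bicolored_act1 : bicolored_act^~ 1%g =1 id.
Proof.
by move=> g; apply: bicolored_ext => [x|x y];
  rewrite ?color_act ?adj_act invg1 !perm1.
Qed.

Lemma bicolored_actM g : act_morph bicolored_act g.
Proof.
by move=> s t; apply: bicolored_ext => [x|x y];
  rewrite ?color_act ?adj_act invMg !permM.
Qed.

Definition bicolored_action := TotalAction bicolored_act1 bicolored_actM.

Lemma mem_orbit_bicolored g h :
  (h \in orbit bicolored_action [set: {perm V}] g) = bicolored_iso g h.
Proof.
apply/orbitP/bicolored_isoP => [[s _ <-]|[s [sc se]]]; exists s => //.
  by split=> [x|x y]; rewrite ?color_act ?adj_act !permK.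
by apply: bicolored_ext => [x|x y];
  rewrite ?color_act ?adj_act -?sc -?se !permKV.
Qed.

Lemma burnside_bicolored :
  #|equivalence_partition (@bicolored_iso V) setT| * #|V|`! =
  \sum_(s : {perm V}) #|[set g | bicolored_act g s == g]|.
Proof.
have := @Frobenius_Cauchy _ _ _ bicolored_action [set: {perm V}]%G setT.
have -> : [acts [set: {perm V}], on setT | bicolored_action]%g.
  by apply/subsetP => s _; rewrite !inE; apply/subsetP => g; rewrite !inE.
move=> /(_ isT).
have -> : #|[set: {perm V}]| = #|V|`!.
  rewrite -[in RHS]cardsT -card_perm cardsT; apply: eq_card => s.
  by rewrite !inE; apply/esym/subsetP => x; rewrite inE.
have -> : equivalence_partition (@bicolored_iso V) setT =
    [set orbit bicolored_action [set: {perm V}] g | g in setT].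
  apply: eq_imset => g; apply/setP => h.
  by rewrite !inE mem_orbit_bicolored.
move=> <-; apply: eq_big => [s|s _]; first by rewrite inE.
by apply: eq_card => g; rewrite !inE /= sub1set inE.
Qed.

Definition green g : {set V} := [set x | color g x].

Definition green_red g : {set V * V} :=
  [set p in setX (green g) (~: green g) | adj g p.1 p.2].

Lemma mem_green_red g x y :
  ((x, y) \in green_red g) = color g x && adj g x y.
Proof.
rewrite !inE /=; case: (boolP (adj g x y)) => [/adj_color|]; last by rewrite !andbF.
by case: (color g x); case: (color g y).
Qed.

Lemma green_red_inj g h :
  green g = green h -> green_red g = green_red h -> g = h.
Proof.
move=> /setP eqc /setP eqe.
have eqC x : color g x = color h x by have := eqc x; rewrite !inE.
apply: bicolored_ext => // x y.
have [x_green|x_red] := boolP (color g x).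
  by have := eqe (x, y); rewrite !mem_green_red -eqC x_green.
have [y_green|y_red] := boolP (color g y).
  by have := eqe (y, x); rewrite !mem_green_red -eqC y_green adj_sym [RHS]adj_sym.
by apply/idP/idP => /adj_color; rewrite -?eqC (negbTE x_red) (negbTE y_red).
Qed.

Lemma card_green_class A :
  #|[set g | green g == A]| = 2 ^ (#|A| * (#|V| - #|A|)).
Proof.
rewrite -(cardsC A) addKn -cardsX -card_powerset.
rewrite -(card_in_imset (f := green_red)); last first.
  move=> g h; rewrite !inE => /eqP gA /eqP hA.
  by apply: green_red_inj; rewrite gA hA.
apply: eq_card => S; apply/imsetP/idP => [[g + ->]|].
  by rewrite !inE => /eqP <-; apply/subsetP => p; rewrite !inE => /andP[].
rewrite inE => /subsetP SA.
have SAP x y : (x, y) \in S -> (x \in A) * (y \notin A).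
  by move=> /SA; rewrite !inE => /andP[-> ->].
have gP : bicolored_axiom
    ([ffun x => x \in A],
     [ffun p : V * V => (p \in S) || ((p.2, p.1) \in S)]).
  apply/and3P; split; apply/forallP => x; rewrite /= ?ffunE ?orbb.
  - by apply/negP => /SAP[->].
  - by apply/forallP => y; rewrite !ffunE /= orbC.
  - apply/forallP => y; rewrite !ffunE; apply/implyP.
    by case/orP => /SAP[xA yA]; rewrite ?xA ?(negbTE yA) ?xA.
exists (BicoloredGraph gP).
  by rewrite inE; apply/eqP/setP => x; rewrite inE /color ffunE.
apply/setP => -[x y]; rewrite mem_green_red /color /adj !ffunE /=.
apply/idP/andP => [xyS|[xA /orP[//|/SAP[_]]]]; last by rewrite xA.
by rewrite xyS (SAP _ _ xyS).
Qed.

Lemma card_bicolored_graph :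
  #|[set: bicolored_graph V]| =
  \sum_(k < #|V|.+1) 'C(#|V|, k) * 2 ^ (k * (#|V| - k)).
Proof.
rewrite -sum1_card (partition_big green xpredT) //=.
rewrite (eq_bigr (fun A => 2 ^ (#|A| * (#|V| - #|A|)))) => [|A _]; last first.
  rewrite -card_green_class sum1dep_card; apply: eq_card => g.
  by rewrite !inE.
rewrite (partition_big (fun A => inord #|A| : 'I_#|V|.+1) xpredT) //=.
apply: eq_bigr => k _.
have cardE A : (inord #|A| == k :> 'I_#|V|.+1) = (#|A| == k).
  by rewrite -val_eqE /= inordK // ltnS max_card.
under eq_bigl do rewrite cardE.
under eq_bigr => A /eqP -> do [].
by rewrite sum_nat_const -card_draws cardsE.
Qed.

Lemma green_red_act_fix g s x y : bicolored_act g s = g ->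
  ((s x, s y) \in green_red g) = ((x, y) \in green_red g).
Proof.
by move=> gs; rewrite !mem_green_red -[in LHS]gs color_act adj_act !permK.
Qed.

Lemma card_fixed_green s A :
  #|[set g | (bicolored_act g s == g) && (green g == A)]| <=
  2 ^ ((#|V| ^ 2 + #|[set x | s x == x]| ^ 2) %/ 8).
Proof.
have [g0|noG] := pickP [pred g | (bicolored_act g s == g) && (green g == A)];
    last by rewrite eq_card0 // => g; rewrite inE; exact: noG.
move=> /andP[/eqP g0s /eqP g0A].
have sA x : (s x \in A) = (x \in A).
  by rewrite -g0A !inE -[in LHS]g0s color_act permK.
have ss_inj : injective (fun p : V * V => (s p.1, s p.2)).
  by move=> [x y] [x' y'] /= [/perm_inj -> /perm_inj ->].
pose ss := perm ss_inj; pose P := setX A (~: A).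
have ssE x y : ss (x, y) = (s x, s y) by rewrite permE.
apply: (@leq_trans (2 ^ #|porbit ss @: P|)); last first.
  rewrite leq_pexp2l // leq_divRL //.
  have /(card_porbit_imset (t := ss)) : {in P, forall p, ss p \in P}.
    by move=> [x y]; rewrite ssE !inE !sA.
  rewrite cardsX.
  have -> : [set p in P | ss p == p] =
      setX (A :&: [set x | s x == x]) (~: A :&: [set x | s x == x]).
    apply/setP => -[x y]; rewrite !inE ssE /= xpair_eqE.
    by case: (x \in A); case: (y \in A); case: (s x == x).
  rewrite cardsX.
  have cA := cardsC A.
  have : #|A :&: [set x | s x == x]| + #|~: A :&: [set x | s x == x]| =
         #|[set x | s x == x]|.
    by rewrite -(cardsID A [set x | s x == x]) setIC setDE [in X in _ + X]setIC.
  have := (nat_AGM2 #|A| #|~: A|).1.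
  have := (nat_AGM2 #|A :&: [set x | s x == x]| #|~: A :&: [set x | s x == x]|).1.
  rewrite cA; move=> + + fE; rewrite fE; lia.
apply: leq_trans (card_invariant_sets ss P).
rewrite -(card_in_imset (f := green_red)); last first.
  move=> g h; rewrite !inE => /andP[_ /eqP gA] /andP[_ /eqP hA].
  by apply: green_red_inj; rewrite gA hA.
apply/subset_leq_card/subsetP => _ /imsetP[g + ->].
rewrite !inE => /andP[/eqP gs /eqP gA]; apply/andP; split.
  by apply/subsetP => p; rewrite inE gA => /andP[].
by apply/forallP => -[x y]; rewrite ssE green_red_act_fix.
Qed.

Lemma card_fixed_bicolored s :
  #|[set g | bicolored_act g s == g]| <=
  2 ^ #|V| * 2 ^ ((#|V| ^ 2 + #|[set x | s x == x]| ^ 2) %/ 8).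
Proof.
rewrite -[in 2 ^ #|V|]cardsT -card_powerset -sum_nat_const -sum1_card.
rewrite (partition_big green (mem (powerset [set: V]))) /=; last first.
  by move=> g _; rewrite inE subsetT.
apply: leq_sum => A _; apply: leq_trans (card_fixed_green s A).
by rewrite sum1dep_card subset_leq_card //; apply/subsetP => g; rewrite !inE.
Qed.

Lemma sum_fixed_bicolored :
  \sum_(s : {perm V} | s != 1%g) #|[set g | bicolored_act g s == g]| <=
  2 ^ #|V| * \sum_(r < #|V|.+1 | 0 < r)
    #|V| ^ r * 2 ^ ((#|V| ^ 2 + (#|V| - r) ^ 2) %/ 8).
Proof.
pose moved s := #|[set x | s x != x]|.
have moved_lt s : moved s < #|V|.+1 by rewrite ltnS max_card.
have fixE s : #|[set x | s x == x]| = #|V| - moved s.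
  by rewrite cardsCs; congr (_ - _); apply: eq_card => x; rewrite !inE.
rewrite big_distrr /=.
rewrite (partition_big (fun s => inord (moved s) : 'I_#|V|.+1) (fun r => 0 < r));
  last first.
  move=> s; rewrite inordK // card_gt0; apply: contraNneq => /setP s1.
  by apply/eqP/permP => x; rewrite perm1; have := s1 x; rewrite !inE => /negbFE/eqP.
apply: leq_sum => r _.
apply: (@leq_trans (\sum_(s : {perm V} | moved s == r)
   2 ^ #|V| * 2 ^ ((#|V| ^ 2 + (#|V| - r) ^ 2) %/ 8))).
  rewrite [leqLHS]big_mkcond [leqRHS]big_mkcond /=; apply: leq_sum => s _.
  rewrite -[inord _ == r]val_eqE /= inordK //; 
  case: (s != 1%g) => //=; case: eqP => // sr.
  by rewrite -sr -fixE card_fixed_bicolored.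
by rewrite sum_nat_const mulnCA leq_mul2l leq_mul2r -cardsE card_perm_moving !orbT.
Qed.

End BicoloredGraphs.

Lemma num_unlabeled_bounds (n : nat) :
  \sum_(k < n.+1) 'C(n, k) * 2 ^ (k * (n - k)) <=
    num_unlabeled_bicolored n * n`! <=
  \sum_(k < n.+1) 'C(n, k) * 2 ^ (k * (n - k)) +
  2 ^ n * \sum_(r < n.+1 | 0 < r) n ^ r * 2 ^ ((n ^ 2 + (n - r) ^ 2) %/ 8).
Proof.
have := burnside_bicolored 'I_n; rewrite card_ord => ->.
rewrite (bigD1 (1%g : {perm _})) //=.
rewrite (@eq_card _ _ [set: bicolored_graph 'I_n]) => [|g]; last first.
  by rewrite !inE bicolored_act1 eqxx.
have := card_bicolored_graph 'I_n; rewrite !card_ord => ->.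
rewrite leq_addr leq_add2l /=.
by have := sum_fixed_bicolored 'I_n; rewrite !card_ord.
Qed.

Section CentralBinomial.
Variable n : nat.
Let u := uphalf n.

Let un : u + n./2 = n.
Proof. by rewrite /u uphalf_half -addnA addnn odd_double_half. Qed.

Let u_le : n./2 <= u <= (n./2).+1.
Proof. rewrite /u uphalf_half; case: (odd n); lia. Qed.

Lemma bin_beyond_half_decr (t : nat) : 'C(n, (u + t).+1) <= 'C(n, u + t).
Proof.
rewrite -(leq_pmul2l (ltn0Sn (u + t))) mul_bin_left.
by rewrite leq_mul2r; apply/orP; right; move: un u_le; lia.
Qed.

Lemma bin_beyond_half_le (t : nat) : 'C(n, u + t) <= 'C(n, u).
Proof.
elim: t => [|t]; first by rewrite addn0.
by apply: leq_trans; rewrite addnS bin_beyond_half_decr.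
Qed.

Lemma bin_le_half (k : nat) : 'C(n, k) <= 'C(n, u).
Proof.
have [uk|ku] := leqP u k; first by rewrite -(subnKC uk) bin_beyond_half_le.
rewrite -bin_sub; last by move: un u_le; lia.
rewrite -(@subnKC u (n - k)) ?bin_beyond_half_le //; move: un u_le; lia.
Qed.

Lemma bin_beyond_half_ge (t : nat) :
  'C(n, u) * u.+1 <= 'C(n, u + t) * u.+1 + 'C(n, u) * (t * t.+1).
Proof.
elim: t => [|t IH]; first by rewrite addn0 leq_addr.
suff step : 'C(n, u + t) * u.+1 <= 'C(n, (u + t).+1) * u.+1 + 'C(n, u) * (t.+1).*2.
  apply: leq_trans IH _; rewrite addnS.
  have -> : (t.+1 * t.+2 = t.+1.*2 + t * t.+1)%N by nia.
  by rewrite mulnDr addnA leq_add2r.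
have := mul_bin_left n (u + t); have := bin_beyond_half_decr t.
have := bin_beyond_half_le t.
have [tm|mt] := leqP t n./2; last by rewrite ['C(n, u + t)]bin_small //; move: un; lia.
move=> le_u decr eq_bin; rewrite -(leq_add2r ('C(n, u + t) * t)) -mulnDr.
have -> : u.+1 + t = (n - (u + t)) + (u - n./2 + t.*2).+1 by move: un u_le; lia.
rewrite mulnDr mulnC -eq_bin; move: u_le; nia.
Qed.

Lemma bin_near_half_ge (N k : nat) : k <= n -> k <= u + N -> u <= k + N ->
  'C(n, u) * u.+1 <= 'C(n, k) * u.+1 + 'C(n, u) * (N * N.+1).
Proof.
move=> kn kN Nk.
have [t tN <-] : exists2 t, t <= N & 'C(n, u + t) = 'C(n, k).
  have [uk|ku] := leqP u k.
    by exists (k - u); rewrite ?subnKC //; lia.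
  exists (n - k - u); first by move: un u_le; lia.
  by rewrite subnKC ?bin_sub //; move: un u_le; lia.
apply: leq_trans (bin_beyond_half_ge t) _.
by rewrite leq_add2l leq_mul2l leq_mul ?orbT.
Qed.

Lemma bin_half_gt0 : 0 < 'C(n, u).
Proof. by rewrite bin_gt0 -[leqRHS]un leq_addr. Qed.

Lemma bin_half_ge : 2 ^ n <= n.+1 * 'C(n, u).
Proof.
rewrite -[2]/(1 + 1) expnDn.
apply: (@leq_trans (\sum_(k < n.+1) 'C(n, u))).
  by apply: leq_sum => k _; rewrite !exp1n !muln1 bin_le_half.
by rewrite sum_nat_const card_ord.
Qed.

End CentralBinomial.

From mathcomp Require Import all_classical all_reals all_analysis.
From mathcomp Require Import ring lra.
Import numFieldNormedType.Exports.

Local Open Scope ring_scope.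
Local Open Scope classical_set_scope.

Section SumOverIntegers.
Variables (R : realType) (f : int -> R).
Hypothesis f_ge0 : forall j, 0 <= f j.

Definition symmetric_sum (N : nat) : R := \sum_(i < N.*2.+1) f (i%:Z - N%:Z).

Lemma symmetric_sumS (N : nat) :
  symmetric_sum N.+1 = symmetric_sum N + f N.+1%:Z + f (- N.+1%:Z).
Proof.
rewrite /symmetric_sum doubleS big_ord_recl big_ord_recr /= [LHS]addrC.
congr (_ + _ + _); last by congr (f _); lia.
  by apply: eq_bigr => i _; congr (f _); rewrite /bump /=; lia.
by congr (f _); rewrite /bump /=; lia.
Qed.

Let fsum_shifted (a : int) (n : nat) :
  (\sum_(j \in [set` [seq (i%:Z - a)%R | i <- iota 0 n]]) (f j)%:E)%E =
  (\sum_(i < n) f (i%:Z - a))%:E.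
Proof.
rewrite -fsbig_seq; last first.
  by rewrite map_inj_uniq ?iota_uniq // => i j /addIr [].
rewrite big_map -sumEFin -(big_mkord xpredT (fun i => (f (i%:Z - a))%:E)).
by rewrite /index_iota subn0.
Qed.

Lemma shifted_sum_le_esum (a : int) (n : nat) :
  ((\sum_(i < n) f (i%:Z - a))%:E <= \esum_(j in [set: int]) (f j)%:E)%E.
Proof.
apply: esum_ge.
exists [set` [seq i%:Z - a | i <- iota 0 n]].
  by split; [exact: finite_seq | ].
by rewrite fsum_shifted.
Qed.

Lemma fsum_le_symmetric_sum (A : set int) : finite_set A ->
  exists N, (\sum_(j \in A) (f j)%:E <= (symmetric_sum N)%:E)%E.
Proof.
move=> /finite_seqP[r ->].
pose N := \max_(j <- r) `|j|%N; exists N.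
rewrite /symmetric_sum -fsum_shifted.
apply: lee_fsum_nneg_subset; [exact: finite_seq | exact: finite_seq | | ].
  move=> j; rewrite !mem_setE => jr.
  have jN : (`|j| <= N)%N by apply: leq_bigmax_seq.
  apply/mapP; exists (absz (j + N%:Z)); last by lia.
  by rewrite mem_iota; lia.
by move=> j _; rewrite lee_fin.
Qed.

Lemma esum_symmetric_approx (C : R) : (forall N, symmetric_sum N <= C) ->
  \esum_(j in [set: int]) (f j)%:E \is a fin_num /\
  forall eps, 0 < eps -> exists N,
    fine (\esum_(j in [set: int]) (f j)%:E) - eps < symmetric_sum N.
Proof.
move=> fC.
have fin : \esum_(j in [set: int]) (f j)%:E \is a fin_num.
  rewrite ge0_fin_numE; last by apply: esum_ge0 => j _; rewrite lee_fin.
  apply: (@le_lt_trans _ _ C%:E); last exact: ltry.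
  apply: ge_ereal_sup => _ [A [finA _] <-].
  by have [N /le_trans -> //] := fsum_le_symmetric_sum finA; rewrite lee_fin.
split=> // eps eps0.
have := ub_ereal_sup_adherent eps0 fin.
move=> [_ [A [finA _] <-]].
have [N AN] := fsum_le_symmetric_sum finA; exists N.
rewrite -lte_fin EFinB fineK //.
exact: lt_le_trans AN.
Qed.

End SumOverIntegers.

Section GaussianSum.
Variable R : realType.

Definition gauss (e : bool) (j : int) : R :=
  2 `^ (- ((j%:~R + e%:R / 2) ^+ 2)).

Definition gauss_sum (e : bool) : R :=
  fine (\esum_(j in [set: int]) (gauss e j)%:E).

Lemma theta_constE (n : nat) : theta_const R n = gauss_sum (odd n).
Proof.
rewrite /theta_const /gauss_sum /gauss; case: (odd n); congr fine; apply: eq_esum => j _.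
  by rewrite mul1r.
by rewrite mul0r addr0.
Qed.

Lemma gauss_ge0 (e : bool) (j : int) : 0 <= gauss e j.
Proof. exact: powR_ge0. Qed.

Lemma gauss_le (e : bool) (j : int) : gauss e j <= 2 * 2^-1 ^+ `|j|%N.
Proof.
have -> : 2 * 2^-1 ^+ `|j|%N = 2 `^ (1 - `|j|%N%:R) :> R.
  rewrite powRD; last by rewrite pnatr_eq0 implybT.
  by rewrite powRr1 // powRN powR_mulrn // exprVn.
apply: ler_powR; first by rewrite ler1n.
case: j => j.
  have : 0 <= e%:R :> R by []. rewrite /=.
  have : 0 <= j%:R :> R by []. rewrite -pmulrn => j0 e0.
  have := sqr_ge0 (j%:R - 2^-1 : R). nra.
rewrite NegzE abszN /= mulrNz -pmulrn.
have := sqr_ge0 (j.+1%:R - 1 : R); have := sqr_ge0 (j.+1%:R - 2^-1 : R).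
by case: e => /=; nra.
Qed.

Lemma symmetric_sum_gauss_le (e : bool) (N : nat) :
  symmetric_sum (gauss e) N <= 6.
Proof.
suff : symmetric_sum (gauss e) N <= 6 - 4 * 2^-1 ^+ N.
  by move/le_trans; apply; rewrite gerBl mulr_ge0 // exprn_ge0.
elim: N => [|N IH].
  rewrite /symmetric_sum big_ord1 expr0; apply: le_trans (gauss_le _ _) _.
  by rewrite /= expr0; lra.
rewrite symmetric_sumS.
have := gauss_le e N.+1%:Z; have := gauss_le e (- N.+1%:Z).
rewrite abszN absz_nat; move: IH; rewrite exprS; lra.
Qed.

Lemma gauss_esum_approx (e : bool) :
  \esum_(j in [set: int]) (gauss e j)%:E \is a fin_num /\
  forall eps, 0 < eps -> exists N, gauss_sum e - eps < symmetric_sum (gauss e) N.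
Proof.
exact: (esum_symmetric_approx (gauss_ge0 e) (symmetric_sum_gauss_le e)).
Qed.

Lemma shifted_gauss_sum_le (e : bool) (a : int) (n : nat) :
  \sum_(i < n) gauss e (i%:Z - a) <= gauss_sum e.
Proof.
rewrite -lee_fin fineK; last by have [] := gauss_esum_approx e.
exact: shifted_sum_le_esum.
Qed.

Lemma gauss_sum_ge (e : bool) : 2^-1 <= gauss_sum e.
Proof.
apply: le_trans (shifted_gauss_sum_le e 0 1); rewrite big_ord1 -powR_inv1 //.
apply: ler_powR; first by rewrite ler1n.
by rewrite lerN2 add0r; case: e => /=; nra.
Qed.

Lemma pow2_gauss (n k : nat) : (k <= n)%N ->
  (2 ^ (k * (n - k)))%:R =
  2 `^ ((n ^ 2)%:R / 4) * gauss (odd n) (k%:Z - (uphalf n)%:Z) :> R.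
Proof.
move=> kn; rewrite natrX -powR_mulrn // -powRD; last by rewrite pnatr_eq0 implybT.
congr (_ `^ _); rewrite natrM natrX natrB // intrB -!pmulrn.
have -> : (uphalf n)%:R = ((odd n)%:R + n%:R) / 2 :> R.
  by rewrite -natrD -uphalfK -muln2 natrM mulfK.
by field.
Qed.

End GaussianSum.

Section Limit.
Variable R : realType.

Lemma main_sum_gauss (n : nat) :
  (\sum_(k < n.+1) 'C(n, k) * 2 ^ (k * (n - k)))%N%:R /
    ('C(n, uphalf n)%:R * 2 `^ ((n ^ 2)%:R / 4)) =
  \sum_(k < n.+1) 'C(n, k)%:R / 'C(n, uphalf n)%:R *
    gauss R (odd n) (k%:Z - (uphalf n)%:Z).
Proof.
rewrite natr_sum mulr_suml; apply: eq_bigr => k _.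
rewrite natrM pow2_gauss; last by rewrite -ltnS.
have C0 : 'C(n, uphalf n)%:R != 0 :> R.
  by rewrite pnatr_eq0 -lt0n bin_half_gt0.
have P0 : 2 `^ ((n ^ 2)%:R / 4) != 0 :> R by rewrite gt_eqF // powR_gt0.
by field; apply/andP.
Qed.

Lemma main_sum_le (n : nat) :
  (\sum_(k < n.+1) 'C(n, k) * 2 ^ (k * (n - k)))%N%:R /
    ('C(n, uphalf n)%:R * 2 `^ ((n ^ 2)%:R / 4)) <= gauss_sum R (odd n).
Proof.
rewrite main_sum_gauss; apply: le_trans (shifted_gauss_sum_le _ _ (uphalf n)%:Z n.+1).
apply: ler_sum => k _; rewrite ler_piMl ?gauss_ge0 //.
by rewrite ler_pdivrMr ?mul1r ?ler_nat ?bin_le_half // ltr0n bin_half_gt0.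
Qed.

Lemma main_sum_ge (N n : nat) : (N.*2 <= n)%N ->
  (1 - (N * N.+1)%:R / (uphalf n).+1%:R) * symmetric_sum (gauss R (odd n)) N <=
  (\sum_(k < n.+1) 'C(n, k) * 2 ^ (k * (n - k)))%N%:R /
    ('C(n, uphalf n)%:R * 2 `^ ((n ^ 2)%:R / 4)).
Proof.
move=> Nn; rewrite main_sum_gauss.
set u := uphalf n; set g := gauss R (odd n).
have Nu : (N <= u)%N by rewrite geq_uphalf_double leqW.
have uNn : (u + N <= n)%N.
  by have := uphalf_half n; have := odd_double_half n; rewrite -/u; lia.
have C0 : 0 < 'C(n, u)%:R :> R by rewrite ltr0n bin_half_gt0.
rewrite -(big_mkord xpredT (fun k => 'C(n, k)%:R / 'C(n, u)%:R * g (k%:Z - u%:Z))).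
rewrite (big_cat_nat (n := (u - N)%N)) ?leq0n //=; last by lia.
rewrite [X in _ <= _ + X](big_cat_nat (n := (u + N).+1)) /=; [|by lia|by lia].
rewrite addrCA ler_wpDr //.
  by rewrite addr_ge0 // sumr_ge0 // => k _; rewrite mulr_ge0 ?gauss_ge0 // divr_ge0.
rewrite -{1}[(u - N)%N]add0n big_addn.
have -> : ((u + N).+1 - (u - N) = N.*2.+1)%N by lia.
rewrite big_mkord /symmetric_sum mulr_sumr; apply: ler_sum => i _.
have -> : (i + (u - N))%N%:Z - u%:Z = i%:Z - N%:Z by lia.
apply: ler_wpM2r; first exact: gauss_ge0.
have : ('C(n, u) * u.+1 <= 'C(n, i + (u - N)) * u.+1 + 'C(n, u) * (N * N.+1))%N.
  by apply: bin_near_half_ge; rewrite -/u; have := ltn_ord i; lia.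
rewrite -(ler_nat R) natrD ![in X in X -> _](natrM R) => le_bin.
have L0 : 0 < u.+1%:R :> R by rewrite ltr0n.
have -> : 1 - (N * N.+1)%:R / u.+1%:R = (u.+1%:R - (N * N.+1)%:R) / u.+1%:R :> R.
  by rewrite mulrBl divff // gt_eqF.
rewrite ler_pdivlMr // mulrAC ler_pdivrMr //.
rewrite [(N * _)%:R]natrM; lra.
Qed.

Lemma error_term_le (n r : nat) : (r <= n)%N ->
  (2 ^ ((n ^ 2 + (n - r) ^ 2) %/ 8))%:R <=
  2 `^ ((n ^ 2)%:R / 4) * (2 `^ (- (n%:R / 8))) ^+ r :> R.
Proof.
move=> rn; rewrite natrX -!powR_mulrn ?powR_ge0 // -powRrM -powRD; last first.
  by rewrite pnatr_eq0 implybT.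
apply: ler_powR; first by rewrite ler1n.
have : (8 * ((n ^ 2 + (n - r) ^ 2) %/ 8) + r * n <= 2 * n ^ 2)%N.
  have := leq_divM (n ^ 2 + (n - r) ^ 2) 8.
  by rewrite mulnC; move: rn; move: (_ %/ _)%N => E; nia.
rewrite -(ler_nat R) natrD !natrM; lra.
Qed.

Lemma error_sum_le (n : nat) :
  let q := 2 `^ (- (n%:R / 8)) : R in n%:R * q <= 1 ->
  (2 ^ n * \sum_(r < n.+1 | 0 < r)
    n ^ r * 2 ^ ((n ^ 2 + (n - r) ^ 2) %/ 8))%N%:R /
  ('C(n, uphalf n)%:R * 2 `^ ((n ^ 2)%:R / 4)) <=
  n.+1%:R ^+ 2 * (n%:R * q).
Proof.
move=> q nq1; have q0 : 0 <= q by exact: powR_ge0.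
have nq0 : 0 <= n%:R * q by rewrite mulr_ge0.
set P := 2 `^ ((n ^ 2)%:R / 4); have P0 : 0 < P by exact: powR_gt0.
have C0 : 0 < 'C(n, uphalf n)%:R :> R.
  by rewrite ltr0n bin_half_gt0.
rewrite ler_pdivrMr ?mulr_gt0 // natrM.
have -> : n.+1%:R ^+ 2 * (n%:R * q) * ('C(n, uphalf n)%:R * P) =
    n.+1%:R * 'C(n, uphalf n)%:R * (P * (n.+1%:R * (n%:R * q))) by ring.
apply: ler_pM => //; first by rewrite -natrM ler_nat bin_half_ge.
have -> : n.+1%:R * (n%:R * q) = \sum_(r < n.+1) n%:R * q.
  by rewrite sumr_const card_ord mulr_natl.
rewrite natr_sum mulr_sumr [leLHS]big_mkcond; apply: ler_sum => r _.
case: ifP => [r0|_]; last by rewrite mulr_ge0 // ltW.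
rewrite natrM natrX.
apply: (@le_trans _ _ (n%:R ^+ r * (P * q ^+ r))).
  by apply: ler_wpM2l; rewrite ?exprn_ge0 // error_term_le // -ltnS.
rewrite mulrCA -exprMn ler_wpM2l ?(ltW P0) // -(prednK r0) exprS.
by rewrite ler_piMr // exprn_ile1.
Qed.

Lemma cvg_polynomial_exponential :
  n.+1%:R ^+ 2 * (n%:R * 2 `^ (- (n%:R / 8))) @[n --> \oo] --> (0 : R).
Proof.
pose c : R := ln 2 / 8; have c0 : 0 < c by rewrite divr_gt0 // ln_gt0 // ltr1n.
have powE n : 2 `^ (- (n%:R / 8)) = (expR (c * n%:R))^-1 :> R.
  by rewrite -expRN /powR pnatr_eq0 /= /c; congr expR; field.
have K0 : 0 < 192 / c ^+ 4 by rewrite divr_gt0 // exprn_gt0.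
apply: (@squeeze_cvgr _ _ _ _ (fun=> 0) (fun n => 192 / c ^+ 4 * harmonic n)).
- near=> n; rewrite !mulr_ge0 ?exprn_ge0 ?powR_ge0 //=.
  rewrite /harmonic powE mulrA ler_pdivrMr ?expR_gt0 // [leRHS]mulrAC ler_pdivlMr ?ltr0n //.
  have := @expR_ge1Dxn R (c * n%:R) 3 (mulr_ge0 (ltW c0) (ler0n _ _)).
  rewrite exprMn => exp_ge.
  apply: (@le_trans _ _ (8 * n%:R ^+ 4)).
    have n1 : 1 <= n%:R :> R by rewrite ler1n; near: n; exact: nbhs_infty_gt.
    have n1le : n.+1%:R <= 2 * n%:R :> R by rewrite -natr1; lra.
    have -> : n.+1%:R ^+ 2 * n%:R * n.+1%:R = n.+1%:R ^+ 3 * n%:R :> R by ring.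
    have -> : 8 * n%:R ^+ 4 = (2 * n%:R) ^+ 3 * n%:R :> R by ring.
    by rewrite ler_wpM2r // lerXn2r // nnegrE ?mulr_ge0.
  have -> : 8 * n%:R ^+ 4 = 192 / c ^+ 4 * (c ^+ 4 * n%:R ^+ 4 / 4`!%:R) :> R.
    by rewrite !factS fact0; field; rewrite gt_eqF.
  by rewrite ler_wpM2l ?(ltW K0) //; apply: le_trans exp_ge; rewrite ler_wpDl.
- exact: cvg_cst.
- rewrite -[X in _ --> X](mulr0 (192 / c ^+ 4)).
  exact: cvgMl_tmp cvg_harmonic.
Unshelve. all: by end_near. Qed.

Let scaled_count (n : nat) : R :=
  (num_unlabeled_bicolored n * n`!)%N%:R /
    ('C(n, uphalf n)%:R * 2 `^ ((n ^ 2)%:R / 4)).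

Lemma scaled_count_near (e : bool) (eps : R) : 0 < eps ->
  \forall n \near \oo, odd n = e -> `|gauss_sum R e - scaled_count n| <= eps.
Proof.
move=> eps0; have eps2 : 0 < eps / 2 by rewrite divr_gt0.
have [N gaussN] := (gauss_esum_approx R e).2 _ eps2.
pose K : R := 6 * (N * N.+1)%:R.
have err_near : \forall n \near \oo,
    n.+1%:R ^+ 2 * (n%:R * 2 `^ (- (n%:R / 8))) < Num.min eps 1 :> R.
  apply: (cvgr_lt (0 : R)); first exact: cvg_polynomial_exponential.
  by rewrite lt_min eps0 ltr01.
apply: filterS3 err_near (nbhs_infty_ge N.*2) (nbhs_infty_ger ((eps / 2)^-1 * K * 2)).
move=> n err_small nN Kn odd_n; rewrite -{}odd_n in gaussN *.
have scale0 : 0 < 'C(n, uphalf n)%:R * 2 `^ ((n ^ 2)%:R / 4) :> R.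
  by rewrite mulr_gt0 ?powR_gt0 // ltr0n bin_half_gt0.
have /andP[count_ge count_le] := num_unlabeled_bounds n.
have main_ge := main_sum_ge nN; have main_le := main_sum_le n.
have sum_le := symmetric_sum_gauss_le R (odd n) N.
have lower : gauss_sum R (odd n) - eps <= scaled_count n.
  apply: (@le_trans _ _ ((\sum_(k < n.+1) 'C(n, k) * 2 ^ (k * (n - k)))%N%:R /
    ('C(n, uphalf n)%:R * 2 `^ ((n ^ 2)%:R / 4)))); last first.
    by rewrite ler_pM2r ?invr_gt0 // ler_nat.
  apply: le_trans main_ge.
  have D0 : 0 <= (N * N.+1)%:R / (uphalf n).+1%:R :> R by rewrite divr_ge0.
  have D_le : 6 * ((N * N.+1)%:R / (uphalf n).+1%:R) <= eps / 2 :> R.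
    rewrite mulrA -/K ler_pdivrMr ?ltr0n // -ler_pdivrMl //.
    apply: (@le_trans _ _ ((n%:R) / 2)).
      by rewrite ler_pdivlMr.
    rewrite ler_pdivrMr // -natrM ler_nat muln2 doubleS uphalfK; lia.
  have := ler_wpM2l D0 sum_le; move: gaussN D_le; rewrite mulrBl mul1r.
  move: (_ / (uphalf n).+1%:R) => D; lra.
have upper : scaled_count n <= gauss_sum R (odd n) + eps.
  move: (ltW err_small); rewrite le_min => /andP[err_eps err1].
  have nq1 : n%:R * 2 `^ (- (n%:R / 8)) <= 1 :> R.
    apply: le_trans err1; rewrite ler_peMl ?mulr_ge0 ?powR_ge0 //.
    by rewrite exprn_ege1 // ler1n.
  have err_le := le_trans (error_sum_le nq1) err_eps.
  apply: le_trans (lerD main_le err_le).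
  by rewrite -mulrDl -natrD ler_pM2r ?invr_gt0 // ler_nat.
by rewrite ler_distlC lower upper.
Qed.

Lemma ratio_scaled_count (n : nat) :
  (num_unlabeled_bicolored n)%:R /
    (theta_const R n / ((n./2)`!%:R * (uphalf n)`!%:R) * 2 `^ ((n ^ 2)%:R / 4)) =
  scaled_count n / gauss_sum R (odd n).
Proof.
rewrite theta_constE /scaled_count.
have un : (n - uphalf n = n./2)%N.
  by rewrite uphalf_half -{1}(odd_double_half n) -addnn addnA addKn.
have u_le : (uphalf n <= n)%N by rewrite leq_uphalf_double -addnn leq_addr.
rewrite natrM -(bin_fact u_le) un !natrM.
have C0 : 'C(n, uphalf n)%:R != 0 :> R by rewrite pnatr_eq0 -lt0n bin_half_gt0.
have m0 : (n./2)`!%:R != 0 :> R by rewrite pnatr_eq0 -lt0n fact_gt0.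
have u0 : (uphalf n)`!%:R != 0 :> R by rewrite pnatr_eq0 -lt0n fact_gt0.
have P0 : 2 `^ (n%:R * n%:R / 4) != 0 :> R by rewrite gt_eqF // powR_gt0.
have g0 : gauss_sum R (odd n) != 0.
  by rewrite gt_eqF //; apply: lt_le_trans (gauss_sum_ge R _); rewrite invr_gt0.
by field; rewrite g0 P0 C0 u0 m0.
Qed.

End Limit.

Theorem lemma3p8 (R : realType) :
  (num_unlabeled_bicolored n)%:R /
    (theta_const R n / ((n./2)`!%:R * (uphalf n)`!%:R)
       * 2 `^ ((n ^ 2)%:R / 4))
    @[n --> \oo] --> (1 : R).
Proof.
apply/cvgrPdist_le => eps eps0; have eps2 : 0 < eps / 2 by rewrite divr_gt0.
apply: filterS2 (scaled_count_near true eps2) (scaled_count_near false eps2).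
move=> n odd_near even_near; rewrite ratio_scaled_count.
have g_ge := gauss_sum_ge R (odd n).
have g_gt0 : 0 < gauss_sum R (odd n) by apply: lt_le_trans g_ge; rewrite invr_gt0.
rewrite -[X in `|X - _|](divff (lt0r_neq0 g_gt0)) -mulrBl normrM normfV (gtr0_norm g_gt0).
rewrite ler_pdivrMr //; apply: (@le_trans _ _ (eps / 2)); last by rewrite ler_pM2l.
by case: (odd n) odd_near even_near => [near_theta _|_ near_theta]; exact: near_theta.
Qed.
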